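(* Let $m\ge 3$ and $q\ge 2$ be integers and let $\Gamma$ be a finite generalized $m$--gon of order $q$. Then $\Gamma$ has $(n,2m)$--branching, where $n=q$ if $m>3$ and $n=\lfloor q+1-\sqrt{q}\rfloor$ if $m=3$.
   Context: A generalized $m$--gon of order $q$, for $m,q\ge 2$, is a bipartite (simplicial) graph of diameter $m$ and girth $2m$ such that every vertex has valence at least $q+1$. Graphs are simplicial. For a vertex $x$ of a graph, $\operatorname{Lk}(x)$ denotes the set of neighbors of $x$. A subgraph is induced if it contains every edge of the ambient graph joining two of its vertices. Definition ($(n,k)$--branching). For $n\ge 1$ and $k\ge 5$, a finite simplicial graph $\Gamma$ has $(n,k)$--branching if every vertex has valence at least $n+1$ and for every induced path $P$ of length 1 or 2 with endpoints $u$ and $v$ the following holds: for every set $\{u_1,\dots,u_n\}$ of distinct vertices in $\operatorname{Lk}(u)\setminus P$ there exist a set $\{v_1,\dots,v_n\}$ of distinct vertices in $\operatorname{Lk}(v)\setminus P$ and cycle subgraphs $H_1,\dots,H_n$ of $\Gamma$ such that for all $i\ne j$: (i) $5\le |H_i|\le k$, where $|H_i|$ is the length of the cycle; (ii) $H_i$ contains $\{u_i,v_i\}\cup P$; (iii) $H_i\cap H_j=P$; and (iv) $\bigcup_i H_i$ is an induced subgraph of $\Gamma$. *)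

(* Defs.v *)
From mathcomp Require Import all_boot.

Set Implicit Arguments.
Unset Strict Implicit.
Unset Printing Implicit Defensive.

Record sgraph := SGraph {
  vertex :> finType;
  edge : rel vertex;
  edge_sym : symmetric edge;
  edge_irrefl : irreflexive edge }.

Section Graph.
Variable G : sgraph.
Implicit Types (x y u v : G) (s c : seq G).

Definition Lk x : {set G} := [set y | edge x y].

Definition bipartite : Prop :=
  exists col : G -> bool, forall x y, edge x y -> col x != col y.

(* As in path.v, a walk is given by its first vertex x and the sequence s of
   its remaining vertices, so that its length (number of edges) is size s. *)
Definition walk x y s : bool := path (@edge G) x s && (last x s == y).

Definition distance x y (d : nat) : Prop :=
  (exists2 s, walk x y s & size s = d) /\
  (forall s, walk x y s -> d <= size s).

Definition diameter (d : nat) : Prop :=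
  (forall x y, exists2 d', distance x y d' & d' <= d) /\
  (exists x y, distance x y d).

(* ucycleb allows closed walks of length 0 and 2, hence the bound on size c. *)
Definition is_cycle c : bool := (2 < size c) && ucycleb (@edge G) c.

Definition girth (g : nat) : Prop :=
  (exists2 c, is_cycle c & size c = g) /\
  (forall c, is_cycle c -> g <= size c).

(* Edges are encoded as two-element vertex sets. *)
Record subgraph := Subgraph {
  sverts : {set G};
  sedges : {set {set G}} }.

Definition sub_subgraph (H K : subgraph) : bool :=
  (sverts H \subset sverts K) && (sedges H \subset sedges K).

Definition subgraphI (H K : subgraph) : subgraph :=
  Subgraph (sverts H :&: sverts K) (sedges H :&: sedges K).

Definition subgraph_bigU (I : finType) (H : I -> subgraph) : subgraph :=
  Subgraph (\bigcup_i sverts (H i)) (\bigcup_i sedges (H i)).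

Definition induced (H : subgraph) : Prop :=
  forall x y, x \in sverts H -> y \in sverts H -> edge x y ->
    [set x; y] \in sedges H.

(* The sequence s lists all the vertices of the path, both endpoints included. *)
Definition path_subgraph s : subgraph :=
  Subgraph [set:: s] [set:: [seq [set xy.1; xy.2] | xy <- zip s (behead s)]].

Definition cycle_subgraph c : subgraph :=
  Subgraph [set:: c] [set:: [seq [set xy.1; xy.2] | xy <- zip c (rot 1 c)]].

Definition induced_path u s : Prop :=
  [/\ path (@edge G) u s, uniq (u :: s) & induced (path_subgraph (u :: s))].

End Graph.

Definition generalized_polygon (m q : nat) (G : sgraph) : Prop :=
  [/\ 2 <= m /\ 2 <= q, bipartite G, diameter G m, girth G (2 * m)
    & forall x : G, q + 1 <= #|Lk x|].

(* The endpoints of P are u and last u s; the sets {u_1, ..., u_n} and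
   {v_1, ..., v_n} are injective families us and vs; H_i is the subgraph carried
   by the cyclic sequence c i, so that its length |H_i| is size (c i). *)
Definition branching (n k : nat) (G : sgraph) : Prop :=
  [/\ 1 <= n /\ 5 <= k,
      forall x : G, n + 1 <= #|Lk x|
    & forall (u : G) (s : seq G), induced_path u s -> 1 <= size s <= 2 ->
      let v := last u s in
      let P := path_subgraph (u :: s) in
      forall us : 'I_n -> G, injective us ->
        (forall i, us i \in Lk u :\: sverts P) ->
      exists (vs : 'I_n -> G) (c : 'I_n -> seq G),
        let H i := cycle_subgraph (c i) in
        [/\ injective vs /\ (forall i, vs i \in Lk v :\: sverts P),
            forall i, is_cycle (c i) /\ 5 <= size (c i) <= k,
            forall i, [set us i; vs i] \subset sverts (H i)
                      /\ sub_subgraph P (H i),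
            forall i j, i != j -> subgraphI (H i) (H j) = P
          & induced (subgraph_bigU H)]].

(* Main.v *)
Require Import Defs.
From mathcomp Require Import all_boot all_order all_algebra all_field.
From mathcomp Require Import zify.
Import Order.TTheory GRing.Theory Num.Theory.

Set Implicit Arguments.
Unset Strict Implicit.
Unset Printing Implicit Defensive.

(* Girth [2m] makes simple paths with common end points and total length less
   than [2m] equal, and makes every non-backtracking walk of length at most
   [m + 1] simple; diameter [m] and bipartiteness then close every simple path
   of length [m + 1] up to a [2m]-cycle.  Hence [u_i, P, v_i] extends to a
   [2m]-cycle [P ++ t_i] for any choice of distinct [v_i], and the girth forces
   the arcs [t_i] to be disjoint and, if [P] has length 2, without edges between
   them.  If [P] is an edge [uv], the only possible edges between arcs join the
   vertex [x_i] of [t_i] at distance [m - 1] from [u] to the vertex [y_j] of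
   [t_j] at distance [m - 1] from [v].

   In that case fix a further neighbor [v_0] of [v] and a vertex [l] opposite
   [u] reached through [v] and [v_0], let each [x_i] be the neighbor of [l] in the
   direction of [u_i], and take [v_i] different from [v_0]: an edge [x_i y_j]
   would give the 4-cycle [l, x_i, y_j, x_j].  This yields [q - 1] cycles, which
   is enough for [m = 3] since [q + 1 - sqrt q < q].  For [m > 3] a last cycle
   through [v_0] is obtained by choosing its vertex at distance 2 from [u] away
   from the at most [q - 1] directions leading to the [y_i], and its vertex at
   distance 3 away from [l]. *)

(** * Simple paths and cycles in a simplicial graph *)

Section SimplePaths.
Variable G : sgraph.
Implicit Types (u v w x y z : G) (p q s t c : seq G).

Definition simple_path x p : bool := path (@edge G) x p && uniq (x :: p).

Lemma simple_path_cons x y p :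
  simple_path x (y :: p) = [&& edge x y, x \notin y :: p & simple_path y p].
Proof.
rewrite /simple_path /=; case: (edge x y) => //=.
by case: (path _ y p); rewrite ?andbF.
Qed.

Lemma mem_split x s : x \in s -> exists p q, s = p ++ x :: q.
Proof. by case/splitPr => p q; exists p, q. Qed.

Lemma edge_neq x y : edge x y -> x != y.
Proof. by apply: contraTneq => ->; rewrite edge_irrefl. Qed.

Lemma simple_path1 x y : edge x y -> simple_path x [:: y].
Proof. by move=> xy; rewrite /simple_path /= xy inE edge_neq. Qed.

Lemma simple_path_prefix x p q : simple_path x (p ++ q) -> simple_path x p.
Proof.
rewrite /simple_path cat_path -cat_cons cat_uniq.
by move=> /andP[/andP[-> _] /andP[-> _]].
Qed.

Lemma simple_path_suffix x y p q :
  simple_path x (p ++ y :: q) -> simple_path y q.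
Proof.
rewrite /simple_path cat_path -cat_cons cat_uniq /=.
by move=> /andP[/and3P[_ _ ->] /and3P[_ _ ->]].
Qed.

Lemma simple_path_cat x p q :
  simple_path x p -> simple_path (last x p) q ->
  {in q, forall z, z \notin x :: p} -> simple_path x (p ++ q).
Proof.
rewrite /simple_path cat_path -cat_cons cat_uniq.
move=> /andP[-> ->] /andP[-> /=/andP[_ ->]] pqN; rewrite andbT.
by apply/hasPn => z /pqN.
Qed.

Lemma is_cycle_cons x p :
  is_cycle (x :: p) = [&& 1 < size p, edge (last x p) x & simple_path x p].
Proof.
rewrite /is_cycle /ucycleb /simple_path [cycle _ _]/= rcons_path /= ltnS.
by rewrite -!andbA; congr (_ && _); rewrite andbCA.
Qed.

Lemma is_cycle_catC p q : is_cycle (p ++ q) = is_cycle (q ++ p).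
Proof.
rewrite /is_cycle -(rot_size_cat p q) size_rot; congr (_ && _).
by rewrite /ucycleb rot_cycle rot_uniq.
Qed.

Lemma is_cycle_arc x y p q :
  is_cycle (x :: p ++ y :: q) -> simple_path y (rcons q x).
Proof.
rewrite -cat_cons is_cycle_catC cat_cons is_cycle_cons => /and3P[_ _].
by rewrite -cat_rcons; apply: simple_path_prefix.
Qed.

Lemma simple_path_rev x y p :
  simple_path x (rcons p y) -> simple_path y (rcons (rev p) x).
Proof.
rewrite /simple_path => /andP[px up]; apply/andP; split; last first.
  by move: up; rewrite -rev_uniq rev_cons rev_rcons rcons_cons.
have := rev_path (@edge G) x (rcons p y).
rewrite last_rcons belast_rcons rev_cons => ->; move: px.
rewrite (@eq_path _ _ (@edge G)) // => a b; exact: edge_sym.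
Qed.

(** Goes out along [p] and returns along [q] reversed; the last condition excludes going back and
    forth on one edge. *)
Lemma is_cycle_disjoint_paths x y p q :
  simple_path x (rcons p y) -> simple_path x (rcons q y) ->
  {in p, forall z, z \notin q} -> 0 < size p + size q ->
  is_cycle (x :: rcons p y ++ rev q).
Proof.
move=> /andP[pP uP] Q pq lg.
have /andP[pQ uQ] := simple_path_rev Q.
rewrite is_cycle_cons size_cat size_rcons size_rev /= addSn ltnS lg.
rewrite last_cat last_rcons; move: pQ uQ; rewrite rcons_path.
move=> /andP[pQ eQ] uQ; rewrite eQ /=; apply/andP; split.
  by rewrite cat_path pP last_rcons.
rewrite -cat_cons cat_uniq uP; move: (uQ); rewrite /= rcons_uniq.
move=> /and3P[yQ _ ->]; rewrite andbT; apply/hasPn => w wq.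
rewrite inE mem_rcons inE; apply/negP => /or3P[/eqP wx|/eqP wy|wp].
- by move: uQ; rewrite /= -wx rcons_uniq wq andbF.
- by move: yQ; rewrite -wy mem_rcons inE wq orbT.
- by move: (pq w wp); rewrite -mem_rev wq.
Qed.

(* Taking the first vertex of [a :: p] that lies on [b :: q] yields a cycle. *)
Lemma cycle_of_diverging_paths x a b p q :
  a != b -> simple_path x (a :: p) -> simple_path x (b :: q) ->
  last a p = last b q ->
  exists2 c : seq G, is_cycle c & size c <= (size p + size q).+2.
Proof.
move=> ab Pa Pb E.
have : has (mem (b :: q)) (a :: p).
  by apply/hasP; exists (last a p); rewrite ?mem_last //= E mem_last.
move Ep : (a :: p) Pa => p' Pa; move Eq : (b :: q) Pb => q' Pb hp.
move: Ep Pa; case: (split_find hp) => z p1 p2 /= zq /hasPn p1q Ep Pa.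
case/splitPr: zq p1q Eq Pb => q1 q2 p1q Eq; rewrite -cat_rcons => Pb.
have sP := simple_path_prefix Pa; have sQ := simple_path_prefix Pb.
exists (x :: rcons p1 z ++ rev q1).
  apply: is_cycle_disjoint_paths => //.
    by move=> w /p1q /=; rewrite mem_cat; case: (w \in q1).
  case: p1 Ep {p1q Pa sP} => [|? ?] //; case: q1 Eq {Pb sQ} => [|? ?] //=.
  by move=> [b1 _] [a1 _]; rewrite a1 b1 eqxx in ab.
have /(congr1 size) := Ep; have /(congr1 size) := Eq.
rewrite /= !size_cat /= !size_rcons size_rev; lia.
Qed.

(** * Rigidity of short paths when all cycles have length at least [g] *)

Section LargeGirth.
Variable g : nat.
Hypothesis girth_ge : forall c : seq G, is_cycle c -> g <= size c.

(** Once the common prefix is removed, diverging remainders would yield a cycle of length at most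
    [size p + size q]. *)
Lemma simple_path_inj x p q :
  simple_path x p -> simple_path x q -> last x p = last x q ->
  size p + size q < g -> p = q.
Proof.
elim: p x q => [|a p IH] x [|b q] //.
- by move=> _ /andP[_ /= /andP[xq _]] E; rewrite E mem_last in xq.
- by move=> /andP[_ /= /andP[xq _]] _ E; rewrite -E mem_last in xq.
move=> Pa Pb E lg; have [ab|ab] := eqVneq a b.
  rewrite -ab in Pb E *; congr (_ :: _); apply: (IH a) => //.
  - exact: (@simple_path_suffix x a [::] p).
  - exact: (@simple_path_suffix x a [::] q).
  - by move: lg => /=; lia.
have [c /girth_ge gc sc] := cycle_of_diverging_paths ab Pa Pb E.
move: lg gc sc => /=; lia.
Qed.

(** If [z] were on the path, the segment from [z] to [y] and the edge [zy] would be short paths with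
    the same ends, hence equal, and [z] would be the predecessor of [y]. *)
Lemma simple_path_rcons x y z p :
  simple_path x (rcons p y) -> edge y z -> z != last x p -> size p + 2 < g ->
  simple_path x (rcons (rcons p y) z).
Proof.
move=> P yz zx lg.
have yNz : y != z by rewrite edge_neq.
have [zin|] := boolP (z \in x :: rcons p y); last first.
  move=> zN; case/andP: (P) => P1 P2; apply/andP; split.
    by rewrite rcons_path last_rcons P1.
  by rewrite -rcons_cons rcons_uniq zN.
exfalso; move: zin; rewrite inE => /orP[/eqP zE|].
  have S : simple_path x [:: y].
    by rewrite -zE simple_path1 // edge_sym.
  have := simple_path_inj P S; rewrite last_rcons size_rcons /=.
  move=> /(_ erefl) H; have {}H : rcons p y = [:: y] by apply: H; lia.
  move: zx; rewrite zE; case: p H {P lg} => [|a p] /=; first by rewrite eqxx.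
  by case: p.
rewrite mem_rcons inE eq_sym (negbTE yNz) /= => zin.
case/splitPr: zin P zx lg => p1 p2; rewrite rcons_cat rcons_cons => P zx lg.
have S := simple_path_suffix P.
have Sy : simple_path z [:: y].
  by rewrite simple_path1 // edge_sym.
have := simple_path_inj S Sy; rewrite last_rcons size_rcons /= => /(_ erefl) H.
have {}H : rcons p2 y = [:: y] by apply: H; rewrite size_cat /= in lg; lia.
case: p2 H zx {P lg S} => [|a [|? ?]] //= _.
by rewrite last_cat /= eqxx.
Qed.

(** Mirror image of [simple_path_rcons]. *)
Lemma simple_path_belast x y z p :
  simple_path x (y :: p) -> edge z x -> z != y -> size p + 2 < g ->
  simple_path z (x :: y :: p).
Proof.
move=> P zx zy lg; rewrite simple_path_cons zx P andbT /=.
have zNx : z != x by rewrite edge_neq.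
rewrite inE (negbTE zNx) /=; apply/negP => zin.
have Sz : simple_path x [:: z].
  by rewrite simple_path1 // edge_sym.
have [p1 [p2 E]] : exists p1 p2, y :: p = p1 ++ z :: p2.
  by case/splitPr: zin => p1 p2; exists p1, p2.
move: P; rewrite E -cat_rcons => /simple_path_prefix S.
have := simple_path_inj S Sz; rewrite last_rcons size_rcons /= => /(_ erefl) H.
have {}H : rcons p1 z = [:: z].
  by apply: H; move/(congr1 size): E; rewrite /= size_cat /=; lia.
case: p1 H E {S} => [_|? [|? ?]] //= [yz _].
by rewrite yz eqxx in zy.
Qed.

(** A common inner vertex splits both paths; the two initial pieces, and likewise the two final
    ones, have total length below [g], so they agree. *)
Lemma simple_path_disjoint x p q y z :
  simple_path x (rcons p y) -> simple_path x (rcons q y) -> p != q ->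
  size p + size q + 2 <= g -> z \in p -> z \notin q.
Proof.
move=> P Q pq lg zp; apply/negP => zq; case/eqP: pq.
case/splitPr: zp P lg => p1 p2 P; case/splitPr: zq Q => q1 q2 Q.
rewrite !size_cat /= => lg; move: P Q; rewrite !rcons_cat !rcons_cons => P Q.
have E1 : rcons p1 z = rcons q1 z.
  apply: (@simple_path_inj x); rewrite ?last_rcons ?size_rcons //; last by lia.
  - by move: P; rewrite -cat_rcons => /simple_path_prefix.
  - by move: Q; rewrite -cat_rcons => /simple_path_prefix.
have /rcons_inj[E2] : rcons p2 y = rcons q2 y.
  apply: (@simple_path_inj z); rewrite ?last_rcons ?size_rcons //; last by lia.
  - exact: simple_path_suffix P.
  - exact: simple_path_suffix Q.
by case: (rcons_inj E1) => ->; rewrite E2.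
Qed.

End LargeGirth.
End SimplePaths.

(** * Vertices and edges of path and cycle subgraphs *)

Section SubgraphEdges.
Variable G : sgraph.
Implicit Types (u v w x y z : G) (p q s t c : seq G).

Lemma mem_sverts_cycle c x : (x \in sverts (cycle_subgraph c)) = (x \in c).
Proof. by rewrite in_set. Qed.

Lemma mem_sverts_path s x : (x \in sverts (path_subgraph s)) = (x \in s).
Proof. by rewrite in_set. Qed.

Lemma mem_zip_rot1 x y p q :
  (x, y) \in zip (p ++ x :: y :: q) (rot 1 (p ++ x :: y :: q)).
Proof.
(* An arbitrary [a] in place of the wrap-around vertex makes the statement inductive. *)
suff S a : (x, y) \in zip (p ++ x :: y :: q)
                          (rcons (behead (p ++ x :: y :: q)) a).
  by case: p S => [|b p] S; rewrite rot1_cons; apply: S.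
elim: p => [|b p IH] /=; first by rewrite inE eqxx.
case: p IH => [|c p] IH; first by rewrite /= !inE eqxx orbT.
by rewrite /= inE IH orbT.
Qed.

Lemma mem_zip_behead x y s :
  (x, y) \in zip s (behead s) -> exists p q, s = p ++ x :: y :: q.
Proof.
elim: s => // a [|b s] IH //=; rewrite inE => /orP[/eqP[-> ->]|].
  by exists [::], s.
by move=> /IH[p [r ->]]; exists (a :: p), r.
Qed.

Lemma cycle_edge_rel c x y : is_cycle c ->
  (x, y) \in zip c (rot 1 c) -> [&& edge x y, x \in c & y \in c].
Proof.
case: c => // a l /andP[_ /andP[/= pa _]]; rewrite rot1_cons => xy.
have [xl yl] := (map_f fst xy, map_f snd xy).
move: xl yl; rewrite -/unzip1 -/unzip2 unzip1_zip ?size_rcons //.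
rewrite unzip2_zip ?size_rcons // mem_rcons => -> ->; rewrite !andbT.
suff S b : path (@edge G) a (rcons l b) ->
    (x, y) \in zip (a :: l) (rcons l b) -> edge x y by apply: S xy.
elim: l a {pa xy} => [|d l IH] a /=.
  by rewrite andbT inE => ad /eqP[-> ->].
by move=> /andP[ad pd]; rewrite inE => /orP[/eqP[-> ->] //|]; apply: IH.
Qed.

Lemma sedges_cycleP c (e : {set G}) : is_cycle c ->
  e \in sedges (cycle_subgraph c) ->
  exists x y, [/\ e = [set x; y], edge x y, x \in c & y \in c].
Proof.
move=> cc; rewrite inE => /mapP[[x y] /(cycle_edge_rel cc) /and3P[xy xc yc] ->].
by exists x, y.
Qed.

Lemma sub_path_cycle s t :
  sub_subgraph (path_subgraph s) (cycle_subgraph (s ++ t)).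
Proof.
apply/andP; split; apply/subsetP => z; rewrite !inE.
  by rewrite mem_cat => ->.
move=> /mapP[[x y] /mem_zip_behead[p [r ->]] ->]; apply/mapP.
by exists (x, y) => //; rewrite -catA mem_zip_rot1.
Qed.

(* A chord would split the cycle into two shorter ones. *)
Lemma induced_shortest_cycle c : is_cycle c ->
  (forall c' : seq G, is_cycle c' -> size c <= size c') ->
  induced (cycle_subgraph c).
Proof.
move=> cc cmin x y; rewrite !inE => xc yc xy.
wlog [p1 [p2 [p3 E]]] : x y xc yc xy /
    exists p1 p2 p3, c = p1 ++ x :: p2 ++ y :: p3.
  have : y != x by rewrite eq_sym edge_neq.
  have [p1 [p2 E]] : exists p1 p2, c = p1 ++ x :: p2.
    by case/splitPr: (xc) => p1 p2; exists p1, p2.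
  move=> yx W; move: (yc); rewrite {1}E mem_cat inE (negbTE yx) /= => /orP[yp|yp].
    rewrite setUC; apply: W => //; first by rewrite edge_sym.
    by move: E; case/splitPr: yp => q1 q2 ->; exists q1, q2, p2; rewrite -catA.
  by apply: W => //; move: E; case/splitPr: yp => q1 q2 ->; exists p1, q1, q2.
case: p2 E => [|a p2] E.
  by apply/mapP; exists (x, y); rewrite // E mem_zip_rot1.
(* If nothing lies outside the segment from [x] to [y], then [yx] is the closing edge of [c];
   otherwise the segment and the chord form a shorter cycle. *)
case Ep : (size p1 + size p3) => [|k].
  have [/size0nil p10 /size0nil p30] : size p1 = 0 /\ size p3 = 0 by lia.
  apply/mapP; exists (y, x); last by rewrite setUC.
  rewrite E p10 p30 cat0s rot1_cons cats1 -(rcons_cons x).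
  rewrite zip_rcons ?size_rcons //.
  by rewrite mem_rcons inE eqxx.
have : is_cycle (x :: rcons (a :: p2) y).
  rewrite is_cycle_cons last_rcons edge_sym xy /= size_rcons /=.
  rewrite -rcons_cons; move: cc; rewrite E is_cycle_catC cat_cons is_cycle_cons.
  by rewrite -cat_rcons -catA => /and3P[_ _ /simple_path_prefix].
move=> /cmin; rewrite E !size_cat /= size_rcons size_cat /=; lia.
Qed.

(** Each cycle has minimal length and is therefore induced, so an edge missing from the union would
    join two different arcs. *)
Lemma bigU_cycles_induced n g u s (t : 'I_n -> seq G) :
  (forall c : seq G, is_cycle c -> g <= size c) ->
  (forall i, is_cycle (u :: s ++ t i) /\ size (u :: s ++ t i) = g) ->
  (forall i j x y, i != j -> x \in t i -> y \in t j -> ~~ edge x y) ->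
  induced (subgraph_bigU (fun i => cycle_subgraph (u :: s ++ t i))).
Proof.
move=> gg ct tN x y /bigcupP[i _ xi] /bigcupP[j _ yj] xy.
have ind i' : induced (cycle_subgraph (u :: s ++ t i')).
  have [cc sc] := ct i'; apply: induced_shortest_cycle => // c'.
  by rewrite sc; apply: gg.
have [yi|yNi] := boolP (y \in sverts (cycle_subgraph (u :: s ++ t i))).
  by apply/bigcupP; exists i => //; apply: ind.
have [xj|xNj] := boolP (x \in sverts (cycle_subgraph (u :: s ++ t j))).
  by apply/bigcupP; exists j => //; apply: ind.
have ij : i != j by apply: contraNneq xNj => <-.
move: xi yj yNi xNj; rewrite !mem_sverts_cycle -!cat_cons !mem_cat.
case: (x \in _ :: _) => //; case: (y \in _ :: _) => //= xi yj _ _.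
by have := tN i j x y ij xi yj; rewrite xy.
Qed.

(** Common vertices lie on the path because the arcs are disjoint; a common edge has both ends
    there, and the path is induced. *)
Lemma cyclesI u s t t' :
  induced (path_subgraph (u :: s)) ->
  is_cycle (u :: s ++ t) -> is_cycle (u :: s ++ t') ->
  {in t, forall x, x \notin t'} ->
  subgraphI (cycle_subgraph (u :: s ++ t)) (cycle_subgraph (u :: s ++ t'))
    = path_subgraph (u :: s).
Proof.
move=> ind cc cc' tt'.
have vI : {subset sverts (cycle_subgraph (u :: s ++ t))
            :&: sverts (cycle_subgraph (u :: s ++ t')) <= u :: s}.
  move=> x; rewrite in_setI !mem_sverts_cycle -!cat_cons !mem_cat.
  case: (x \in _ :: _) => //=.
  by move=> /andP[/tt']; case: (x \in t').
have /andP[sV sE] := sub_path_cycle (u :: s) t.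
have /andP[sV' sE'] := sub_path_cycle (u :: s) t'.
congr Subgraph; apply/eqP; rewrite eqEsubset subsetI ?sV ?sV' ?sE ?sE'.
  by rewrite /= andbT; apply/subsetP => x /vI; rewrite mem_sverts_path.
rewrite /= andbT; apply/subsetP => e /setIP[/(sedges_cycleP cc)[x [y [-> xy xc yc]]]].
move=> /(sedges_cycleP cc')[x' [y' [E _ xc' yc']]].
have sub z : z \in [set x; y] -> z \in u :: s ++ t'.
  by rewrite E !inE => /orP[] /eqP ->; rewrite -in_cons.
by apply: ind => //; rewrite mem_sverts_path; apply: vI;
  rewrite in_setI !mem_sverts_cycle ?sub ?set21 ?set22 ?xc ?yc.
Qed.

End SubgraphEdges.

(** * Closing paths to [2m]-cycles in a generalized polygon *)

Section Polygon.
Variables (m q : nat) (G : sgraph).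
Hypotheses (m_ge3 : 3 <= m) (polG : generalized_polygon m q G).
Implicit Types (u v w x y z : G) (p s t c : seq G).

Lemma polygon_q : 2 <= q.
Proof. by case: polG => [[]]. Qed.

Lemma polygon_girth c : is_cycle c -> 2 * m <= size c.
Proof. by case: polG => _ _ _ [_ +] _; apply. Qed.

Lemma polygon_deg x : q < #|Lk x|.
Proof. by case: polG => _ _ _ _ /(_ x); rewrite addn1. Qed.

Lemma path_parity : bipartite G -> forall x p p',
  path (@edge G) x p -> path (@edge G) x p' -> last x p = last x p' ->
  odd (size p) = odd (size p').
Proof.
case=> col colP.
have S p x : path (@edge G) x p -> odd (size p) = col x (+) col (last x p).
  elim: p x => [|y p IH] x /=; first by rewrite addbb.
  move=> /andP[/colP xy /IH ->]; move: xy.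
  by case: (col x); case: (col y); case: (col _).
by move=> x p p' /S -> /S -> ->.
Qed.

(** The diameter gives a path of length at most [m] between the ends, and parity excludes [m]
    itself. Together with [p] it forms a cycle, so the girth makes its length exactly [m - 1]. *)
Lemma close_path x p : simple_path x p -> size p = m.+1 ->
  exists2 t, is_cycle (x :: p ++ t) & size t = m - 2.
Proof.
case: polG => _ bip [diam _] _ _.
case: (lastP p) => [//|p' y] P; rewrite size_rcons => -[sp].
have [s [ps us ls sm]] : exists s,
    [/\ path (@edge G) x s, uniq (x :: s), last x s = y & size s <= m].
  have [d [[s /andP[ps /eqP ls] sd] _] dm] := diam x y.
  case/shortenP: ps ls => s' ps us sub ls; exists s'; split=> //.
  apply: leq_trans dm; rewrite -sd; apply: uniq_leq_size => //.
  by move: us => /andP[].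
have xy : x != y.
  by case/andP: P => _ /= /andP[]; rewrite mem_rcons inE negb_or => /andP[].
case: (lastP s) ps us ls sm => [_ _ xE|s2 y']; first by rewrite -xE eqxx in xy.
rewrite last_rcons => + + yE; rewrite {y'}yE size_rcons => ps us sm.
have Q : simple_path x (rcons s2 y) by apply/andP; split.
have par : odd m.+1 = odd (size s2).+1.
  rewrite -sp -!(size_rcons _ y).
  by apply: (@path_parity bip x); rewrite ?last_rcons //; case/andP: P.
have s2m : size s2 <= m - 2.
  have : (size s2).+1 != m by apply/eqP => E; move: par; rewrite E /=; case: (odd m).
  by lia.
have ps2 : p' != s2 by apply/eqP => E; move: s2m; rewrite -E sp; lia.
have dis : {in p', forall z, z \notin s2}.
  move=> z; apply: (simple_path_disjoint polygon_girth P Q ps2); lia.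
have cc : is_cycle (x :: rcons p' y ++ rev s2).
  by apply: is_cycle_disjoint_paths => //; lia.
exists (rev s2) => //; have := polygon_girth cc.
by rewrite /= size_cat size_rcons size_rev; lia.
Qed.

(** Every vertex has at least three neighbors, so a path can go on without backtracking, and up to
    length [m + 1] the girth keeps it simple. *)
Lemma extend_path x p k : simple_path x p -> 0 < size p <= k -> k <= m.+1 ->
  exists2 t, simple_path x (p ++ t) & size (p ++ t) = k.
Proof.
move=> P pk km; move Ed : (k - size p) => d.
elim: d p P pk Ed => [|d IH] p P pk Ed.
  by exists [::]; rewrite cats0 //; lia.
case: (lastP p) P pk Ed => // p' y P; rewrite size_rcons => pk Ed.
have : 0 < #|Lk y :\ last x p'|.
  have := polygon_deg y; have := polygon_q.
  by rewrite (cardsD1 (last x p')); case: (_ \in _); lia.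
move=> /card_gt0P[z]; rewrite !inE => /andP[zN yz].
have Pz : simple_path x (rcons (rcons p' y) z).
  by apply: (simple_path_rcons polygon_girth) => //; lia.
have [||t Pt st] := IH _ Pz; rewrite ?size_rcons; try lia.
by exists (z :: t); rewrite -cat_rcons.
Qed.

Lemma complete_path x p : simple_path x p -> 0 < size p <= m.+1 ->
  exists2 t, is_cycle (x :: p ++ t) & size (x :: p ++ t) = 2 * m.
Proof.
move=> P /extend_path - /(_ _ P (leqnn _))[t Pt st].
have [t' cc st'] := close_path Pt st.
exists (t ++ t'); rewrite catA //= size_cat st st'; lia.
Qed.

(* The arc [t] runs from [last u s] back to [u].  When [s] is a single vertex
   [v], the entry [m - 2] of [t] is at distance [m - 1] from [v], and the entry
   [m - 1] is at distance [m - 1] from [u]. *)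
Definition closes u s t := is_cycle (u :: s ++ t) /\ size (u :: s ++ t) = 2 * m.

(** * Disjointness of arcs and edges between them *)

Section Arcs.
Variables (u : G) (s : seq G).
Hypothesis s0 : 0 < size s.

Let from_last r : is_cycle (u :: s ++ r) -> simple_path (last u s) r.
Proof.
case: (lastP s) s0 => // s' v _; rewrite last_rcons is_cycle_cons.
by rewrite cat_rcons => /and3P[_ _ /simple_path_suffix].
Qed.

Let to_first x r1 r2 : is_cycle (u :: s ++ r1 ++ x :: r2) ->
  simple_path x (rcons r2 u).
Proof. by rewrite catA; apply: is_cycle_arc. Qed.

(** A common vertex splits each arc. Either the two initial or the two final pieces have total
    length below [2m]; these coincide, contrary to the distinct heads or last entries. *)
Lemma arcs_disjoint t t' : closes u s t -> closes u s t' ->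
  head u t != head u t' -> last u t != last u t' ->
  {in t, forall x, x \notin t'}.
Proof.
move=> [Ct St] [Ct' St'] hd lst x xt; apply/negP => xt'.
move: St St' Ct Ct' hd lst.
have [t1 [t2 ->]] := mem_split xt; have [t1' [t2' ->]] := mem_split xt'.
rewrite /= !size_cat /= !last_cat /= => S1 S2 C1 C2 hd lst.
case: (leqP (2 * m) (size t1 + size t1' + 2)) => lg; last first.
  have E : rcons t1 x = rcons t1' x.
    apply: (simple_path_inj polygon_girth (x := last u s)).
    - by move: (from_last C1); rewrite -cat_rcons => /simple_path_prefix.
    - by move: (from_last C2); rewrite -cat_rcons => /simple_path_prefix.
    - by rewrite !last_rcons.
    - by rewrite !size_rcons; lia.
  move: hd; case: (rcons_inj E) => ->.
  by case: t1' {E lg C2 S2} => [|? ?]; rewrite eqxx.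
have E : rcons t2 u = rcons t2' u.
  apply: (simple_path_inj polygon_girth (to_first C1) (to_first C2)).
    by rewrite !last_rcons.
  by rewrite !size_rcons; lia.
by move: lst; case: (rcons_inj E) => ->; rewrite eqxx.
Qed.

(** Following [s] and [t] from [u] up to [x], crossing to [y] and returning along [t'] gives a
    cycle, which is at least as long as the one through [t]. *)
Lemma arc_end_gap t t' x y t1 t2 t1' t2' : closes u s t -> closes u s t' ->
  t = t1 ++ x :: t2 -> t' = t1' ++ y :: t2' -> {in t, forall x, x \notin t'} ->
  edge x y -> size t2 <= (size t2').+1.
Proof.
move=> [Ct St] [Ct' St'] E E' dis xy.
have yt z : z \in y :: t2' -> z \in t' by rewrite E' mem_cat orbC => ->.
have P : simple_path u (s ++ rcons t1 x).
  move: Ct; rewrite E is_cycle_cons -cat_rcons catA.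
  by move=> /and3P[_ _ /simple_path_prefix].
have P' : simple_path y t2'.
  move: Ct'; rewrite E' is_cycle_cons catA.
  by move=> /and3P[_ _ /simple_path_suffix].
have cc : is_cycle (u :: (s ++ rcons t1 x) ++ y :: t2').
  rewrite is_cycle_cons; apply/and3P; split.
  - by rewrite !size_cat size_rcons /=; lia.
  - by move: Ct'; rewrite E' is_cycle_cons !last_cat /= => /and3P[].
  apply: simple_path_cat => // [|z /yt zt'].
    rewrite last_cat last_rcons simple_path_cons xy P' andbT.
    apply/negP => /yt; apply/negP; apply: dis.
    by rewrite E mem_cat mem_head orbT.
  rewrite -cat_cons mem_cat negb_or; apply/andP; split.
    move: Ct' => /andP[_ /andP[_]]; rewrite -cat_cons cat_uniq.
    by move=> /and3P[_ /hasPn /(_ z zt')].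
  apply/negP => zt; move: zt'; apply/negP; apply: dis.
  by rewrite E -cat_rcons mem_cat zt.
move: (polygon_girth cc) (St); rewrite E /= !size_cat size_rcons /=; lia.
Qed.

(** Compares two routes from [last u s] to [y], and two from [x] to [u], one of each pair using the
    edge [xy]. Being distinct, they have total length at least [2m]. *)
Lemma arcs_edge t t' x y : closes u s t -> closes u s t' ->
  {in t, forall x, x \notin t'} -> x \in t -> y \in t' -> edge x y ->
  size s = 1 /\ (x = nth u t (m - 1) /\ y = nth u t' (m - 2)
             \/ x = nth u t (m - 2) /\ y = nth u t' (m - 1)).
Proof.
move=> Ct Ct' dis xt yt' xy.
have dis' : {in t', forall x, x \notin t}.
  by move=> z zt'; apply: contraL zt' => /dis.
have [t1 [t2 E]] := mem_split xt; have [t1' [t2' E']] := mem_split yt'.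
have g1 := arc_end_gap Ct Ct' E E' dis xy.
have g2 : size t2' <= (size t2).+1.
  by apply: arc_end_gap Ct' Ct E' E dis' _; rewrite edge_sym.
have xNt' := dis x xt; have yNt := dis' y yt'.
have yx : y != x by apply: contraNneq yNt => ->.
move: Ct Ct' => [Ct St] [Ct' St'].
rewrite E E' in Ct Ct' St St' xNt' yNt; rewrite /= !size_cat /= in St St'.
have Q := from_last Ct; have Q' := from_last Ct'.
have h1 : 2 * m <= size t1 + size t1' + 3.
  rewrite leqNgt; apply/negP => lg.
  have P' : simple_path (last u s) (rcons t1' y).
    by move: Q'; rewrite -cat_rcons => /simple_path_prefix.
  have P : simple_path (last u s) (rcons (rcons t1 x) y).
    rewrite -cats1; apply: simple_path_cat => [||z].
    - by move: Q; rewrite -cat_rcons => /simple_path_prefix.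
    - by rewrite last_rcons simple_path1.
    rewrite !inE => /eqP ->; rewrite negb_or; apply/andP; split.
      apply: contraTneq Q' => <-; rewrite /simple_path /= mem_cat mem_head.
      by rewrite orbT andbF.
    by apply: contra yNt; rewrite -cat_rcons mem_cat => ->.
  have : rcons (rcons t1 x) y = rcons t1' y.
    apply: (simple_path_inj polygon_girth P P'); rewrite ?last_rcons //.
    by rewrite !size_rcons; clear -lg; lia.
  by case/rcons_inj => E1; move: xNt'; rewrite -E1 mem_cat mem_rcons mem_head.
have h2 : 2 * m <= size t2 + size t2' + 3.
  rewrite leqNgt; apply/negP => lg.
  have P : simple_path x (y :: rcons t2' u).
    have := to_first Ct'; rewrite simple_path_cons xy => -> /=; rewrite andbT.
    rewrite -rcons_cons mem_rcons inE negb_or; apply/andP; split.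
      have /andP[_ /andP[_ /= /andP[uN _]]] := Ct.
      by apply: contraNneq uN => <-; rewrite catA mem_cat mem_head orbT.
    by apply: contra xNt'; rewrite mem_cat => ->; rewrite orbT.
  have : rcons t2 u = rcons (y :: t2') u.
    apply: (simple_path_inj polygon_girth (to_first Ct) P).
      by rewrite /= !last_rcons.
    by rewrite /= !size_rcons; clear -lg; lia.
  by case/rcons_inj => E1; move: yNt; rewrite E1 mem_cat !inE eqxx !orbT.
(* With the lengths of the arcs, [h1] and [h2] force [size s = 1] and equality; [g1] and [g2] then
   leave only two positions. *)
split; first by clear -s0 St St' h1 h2 g1 g2; lia.
have -> : x = nth u t (size t1) by rewrite E nth_cat ltnn subnn.
have -> : y = nth u t' (size t1') by rewrite E' nth_cat ltnn subnn.
have [[-> ->]|[-> ->]] : size t1 = m - 1 /\ size t1' = m - 2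
                     \/ size t1 = m - 2 /\ size t1' = m - 1.
  by clear -s0 m_ge3 St St' h1 h2 g1 g2; lia.
- by left.
- by right.
Qed.

End Arcs.

(** * Construction of single arcs when [P] is an edge *)

Lemma ord_choice n (A : Type) (P : 'I_n -> A -> Prop) :
  (forall i, exists a, P i a) -> exists f : 'I_n -> A, forall i, P i (f i).
Proof. exact: (@fin_all_exists 'I_n (fun=> A) P). Qed.

Lemma common_neighbor_unique x y a b :
  x != y -> edge x a -> edge x b -> edge a y -> edge b y -> a = b.
Proof.
have P z : x != y -> edge x z -> edge z y -> simple_path x [:: z; y].
  move=> xy xz zy; rewrite simple_path_cons xz simple_path1 // !inE negb_or.
  by rewrite edge_neq // xy.
move=> xy xa xb ay b_y.
have lg : size [:: a; y] + size [:: b; y] < 2 * m by rewrite /=; lia.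
by case: (simple_path_inj polygon_girth (P a xy xa ay) (P b xy xb b_y) erefl lg).
Qed.

Lemma closes_edge u s t k : closes u s t -> k.+1 < size t ->
  edge (nth u t k) (nth u t k.+1).
Proof.
move=> [ct _] kt; move: ct; rewrite is_cycle_cons => /and3P[_ _ /andP[+ _]].
rewrite cat_path => /andP[_ pt].
by have /pathP - /(_ u k.+1 kt) := pt.
Qed.

(** The path from [u'] through [u] to [y] has length [m + 1], and its closing arc leads back to
    [u']. The last entry of [w] is thus the neighbor of [u'] in the direction of [y]. *)
Lemma way_round u u' p y : simple_path u (rcons p y) -> size p = m - 1 ->
  edge u u' -> u' != head y p ->
  exists2 w, simple_path y (rcons w u') & size w = m - 2.
Proof.
case: p => [|v p] P sp uu' u'v; first by move: sp => /=; lia.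
have P' : simple_path u' (u :: v :: rcons p y).
  apply: (simple_path_belast polygon_girth) => //; first by rewrite edge_sym.
  by rewrite size_rcons; move: sp => /=; lia.
have [|w cw sw] := close_path P'; first by rewrite /= size_rcons; move: sp => /=; lia.
exists w => //; move: cw; rewrite -!rcons_cons cat_rcons; exact: is_cycle_arc.
Qed.

(** Here [l = last v0 r] is opposite [u]. The arc is routed through the neighbor [x] of [l] in the
    direction of [u'], so that all spokes have their entry [m - 1] adjacent to the same [l]. *)
Lemma spoke u v v0 r u' v' :
  simple_path u (v :: v0 :: r) -> size r = m - 2 ->
  edge u u' -> u' != v -> edge v v' -> v' != u -> v' != v0 ->
  exists t, [/\ closes u [:: v] t, head u t = v' /\ last u t = u',
    edge (last v0 r) (nth u t (m - 1)),
    simple_path u (v :: v0 :: rcons r (nth u t (m - 1)))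
    & nth u t (m - 2) != last v0 r].
Proof.
move=> P sr uu' u'v vv' v'u v'v0.
have P' : simple_path u' (u :: v :: v0 :: r).
  apply: (simple_path_belast polygon_girth) => //; first by rewrite edge_sym.
  by rewrite /=; lia.
have [|t ct st] := close_path P'; first by rewrite /= sr; lia.
case: t ct st => [|x t1] ct st; first by move: st => /=; clear -m_ge3; lia.
(* From [x] through [t1], [u'], [u], [v] to [v'] there are [m + 1] edges, so the path closes up. *)
have P2 : simple_path x (rcons (rcons (rcons (rcons t1 u') u) v) v').
  apply: (simple_path_rcons polygon_girth) => //.
  - move: ct; rewrite -cat_cons is_cycle_catC cat_cons is_cycle_cons -3!cat_rcons.
    by move=> /and3P[_ _ /simple_path_prefix].
  - by rewrite last_rcons.
  - by move: st; rewrite !size_rcons /=; clear -m_ge3; lia.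
have [|t2 ct2 st2] := close_path P2.
  by move: st; rewrite !size_rcons /=; clear -m_ge3; lia.
have Cl : is_cycle (u :: [:: v] ++ v' :: t2 ++ x :: rcons t1 u').
  move: ct2; rewrite !cat_rcons -cat_cons -cat_rcons is_cycle_catC.
  by rewrite rcons_cons !cat_cons.
have Xm : nth u (v' :: t2 ++ x :: rcons t1 u') (m - 1) = x.
  rewrite -cat_cons nth_cat /= st2 (_ : m - 1 = (m - 2).+1) ?ltnn ?subnn //.
  by clear -m_ge3; lia.
have Ym : nth u (v' :: t2 ++ x :: rcons t1 u') (m - 2) = last v' t2.
  rewrite -cat_cons nth_cat /= st2 ltnSn -st2 -[size t2]/((size (v' :: t2)).-1).
  by rewrite nth_last.
have Px : simple_path u (v :: v0 :: rcons r x).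
  move: ct; rewrite cat_cons is_cycle_cons !cat_cons -cat_rcons.
  move=> /and3P[_ _] /(@simple_path_suffix _ u' u [::]).
  by move=> /(@simple_path_prefix _ u (v :: v0 :: rcons r x)).
exists (v' :: t2 ++ x :: rcons t1 u'); split.
- split; first by [].
  by move: st; rewrite /= size_cat /= size_rcons st2; clear -m_ge3; lia.
- by rewrite /= last_cat /= last_rcons.
- rewrite Xm; move: Px => /andP[+ _].
  by rewrite -!rcons_cons rcons_path => /andP[].
- by rewrite Xm.
(* If the entry [m - 2] were [l], there would be two paths of length [m - 1] from [v] to [l], one
   through [v'] and one through [v0]. *)
rewrite Ym; apply: contra_neq v'v0 => E.
have Q : simple_path v (v' :: t2).
  move: Cl; rewrite is_cycle_cons => /and3P[_ _].
  move=> /(@simple_path_suffix _ u v [::]).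
  by move=> /(@simple_path_prefix _ v (v' :: t2)).
have Q0 : simple_path v (v0 :: r) := @simple_path_suffix _ u v [::] _ P.
have lg : size (v' :: t2) + size (v0 :: r) < 2 * m by rewrite /= st2 sr; clear -m_ge3; lia.
by case: (simple_path_inj polygon_girth Q Q0 E lg).
Qed.

(** Treats the arc that starts with [v0] itself, where [spoke] does not apply. *)
Lemma last_spoke n u v v0 r u0 (T : 'I_n -> seq G) (i0 : 'I_n) :
  3 < m -> n <= q ->
  simple_path u (v :: v0 :: r) -> size r = m - 2 -> edge u u0 -> u0 != v ->
  (forall i, i != i0 ->
    [/\ closes u [:: v] (T i), head u (T i) != v0 & last u (T i) != u0]) ->
  exists t, [/\ closes u [:: v] t, head u t = v0 /\ last u t = u0,
    nth u t (m - 2) != last v0 r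
    & forall i, i != i0 -> ~~ edge (nth u t (m - 1)) (nth u (T i) (m - 2))].
Proof.
move=> m4 nq P sr uu0 u0v HT.
have [w0 Pw0 sw0] : exists2 w, simple_path (last v0 r) (rcons w u0) & size w = m - 2.
  apply: (@way_round u u0 (v :: belast v0 r)) => //.
    by rewrite rcons_cons -lastI.
  by rewrite /= size_belast; lia.
have [w Pw] : exists w : 'I_n -> seq G, forall i, i != i0 ->
    simple_path (nth u (T i) (m - 2)) (rcons (w i) u0) /\ size (w i) = m - 2.
  apply: (@ord_choice _ _ (fun i (b : seq G) => i != i0 ->
    simple_path (nth u (T i) (m - 2)) (rcons b u0) /\ size b = m - 2)) => i.
  have [->|ni] := eqVneq i i0; first by exists [::].
  have [[ct st] _ _] := HT i ni.
  have [||//||w'] := @way_round u u0 (v :: take (m - 2) (T i)) (nth u (T i) (m - 2)).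
  - rewrite rcons_cons -take_nth; last by move: st => /=; lia.
    move: ct; rewrite is_cycle_cons => /and3P[_ _].
    rewrite -{1}(cat_take_drop (m - 2).+1 (T i)) catA.
    exact: simple_path_prefix.
  - by rewrite /= size_take; move: st => /=; case: ifP; lia.
  - by [].
  - by exists w'.
(* At most [1 + (n - 1) <= q] vertices are to be avoided, and [u0] has more than [q] neighbors. *)
have [x2] : exists x2, x2 \in Lk u0 :\: (u |: [set last u0 (w i) | i in [set~ i0]]).
  apply/set0Pn; rewrite setD_eq0; apply/negP => /subset_leq_card.
  have : #|u |: [set last u0 (w i) | i in [set~ i0]]| <= q.
    rewrite cardsU1 (leq_trans _ nq) //.
    have := leq_imset_card (fun i => last u0 (w i)) [set~ i0].
    rewrite cardsC1 card_ord => le.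
    by rewrite -[leqRHS](ltn_predK (ltn_ord i0)) -[leqRHS]add1n leq_add ?leq_b1.
  move=> c1 c2; have := polygon_deg u0; rewrite ltnNge.
  by rewrite (leq_trans c2 c1).
rewrite !inE negb_or => /andP[/andP[x2u x2w] u0x2].
(* The second vertex to avoid is the last but one entry of [w0], which exists since [m - 2 >= 2]. *)
have [x3] : exists x3, x3 \in Lk x2 :\: [set u0; nth u0 (rev w0) 1].
  apply/set0Pn; rewrite setD_eq0; apply/negP => /subset_leq_card.
  have := polygon_deg x2; have := polygon_q; rewrite cards2.
  by case: (_ != _); clear; lia.
rewrite !inE negb_or => /andP[/andP[x3u0 x3w] x2x3].
(* Its length 5 is at most [m + 1] because [m > 3]. *)
have P3 : simple_path x3 [:: x2; u0; u; v; v0].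
  do 3?[apply: (simple_path_belast polygon_girth) => //;
        rewrite 1?edge_sym //=; try by clear -m4; lia].
  by move: P => /(@simple_path_prefix _ u [:: v; v0]).
have [|t' ct' st'] := complete_path P3; first by clear -m4 => /=; lia.
have {}st' : size t' = m + m - 6 by move: st' => /=; clear -m4; lia.
pose t := v0 :: t' ++ [:: x3; x2; u0].
have Cl : closes u [:: v] t.
  split; last by rewrite /t /= size_cat st' /=; clear -m4; lia.
  by move: ct'; rewrite (is_cycle_catC [:: x3; x2; u0] [:: u, v, v0 & t']).
have dt : drop (m - 1) t = drop (m - 2) t' ++ [:: x3; x2; u0].
  rewrite /t (_ : m - 1 = (m - 2).+1) /=; last by clear -m4; lia.
  rewrite drop_cat; case: ltnP => // ge.
  have -> : m - 2 = size t' by move: ge; rewrite st'; clear -m4; lia.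
  by rewrite subnn drop0 drop_size.
have sdt : size (drop (m - 2) t') = m - 4.
  by rewrite size_drop st'; clear -m4; lia.
have tm : m - 1 < size t by rewrite /t /= size_cat st'; clear -m4 => /=; lia.
have P0 : simple_path (nth u t (m - 2)) (drop (m - 1) t).
  case: Cl; rewrite is_cycle_cons => /and3P[_ _].
  rewrite -{1}(cat_take_drop (m - 2) t) (drop_nth u); last by clear -tm; lia.
  by rewrite (_ : (m - 2).+1 = m - 1) ?catA; [move/simple_path_suffix|clear -m4; lia].
(* Two paths of length [m - 1] with the same ends coincide, so [b] must end with [x3], [x2]. This
   contradicts the choice of [x3] for [w0] and that of [x2] for [w i]. *)
have same y b : simple_path y (drop (m - 1) t) -> simple_path y (rcons b u0) ->
    size b = m - 2 -> b = drop (m - 2) t' ++ [:: x3; x2].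
  move=> Py Pb sb.
  have E : rcons b u0 = drop (m - 1) t.
    apply: (simple_path_inj polygon_girth Pb Py).
      by rewrite dt last_rcons last_cat.
    by rewrite dt size_rcons size_cat sdt sb /=; clear -m4; lia.
  move: E; rewrite dt -[[:: x3; x2; u0]]/(rcons [:: x3; x2] u0) -rcons_cat.
  by case/rcons_inj.
have lt : last u t = u0 by rewrite /t /= last_cat.
exists t; split=> //.
  apply: contraNneq x3w => E; rewrite E in P0.
  by rewrite (same _ _ P0 Pw0 sw0) rev_cat.
move=> i ni; have [Ci hi li] := HT i ni; have [Pwi swi] := Pw i ni.
apply: contra x2w => XY; apply/imsetP; exists i; first by rewrite !inE.
rewrite (same (nth u (T i) (m - 2)) (w i)) ?last_cat //.
have dis := arcs_disjoint (isT : 0 < size [:: v]) Ci Cl hi.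
rewrite (drop_nth u tm) simple_path_cons edge_sym XY -drop_nth // /=.
apply/andP; split.
  apply: contra (dis _ _ (mem_nth u _)); first exact: mem_drop.
    by rewrite lt.
  by case: Ci => _ /=; clear -m4; lia.
case: Cl; rewrite is_cycle_cons => /and3P[_ _].
by rewrite -{1}(cat_take_drop (m - 1) t) (drop_nth u tm) catA => /simple_path_suffix.
Qed.

(** * From families of arcs to branching *)

(** Distinct ends make the arcs disjoint, and [arcs_edge] leaves only the edges that the last
    hypothesis excludes. *)
Lemma branching_conclusion n u s (us vs : 'I_n -> G) (t : 'I_n -> seq G) :
  0 < size s <= 2 -> induced_path u s -> injective us -> injective vs ->
  (forall i, vs i \in Lk (last u s) :\: sverts (path_subgraph (u :: s))) ->
  (forall i, [/\ closes u s (t i), head u (t i) = vs i & last u (t i) = us i]) ->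
  (size s = 1 -> forall i j, i != j ->
    ~~ edge (nth u (t i) (m - 1)) (nth u (t j) (m - 2))) ->
  exists (vs : 'I_n -> G) (c : 'I_n -> seq G),
    let H i := cycle_subgraph (c i) in
    [/\ injective vs /\
          (forall i, vs i \in Lk (last u s) :\: sverts (path_subgraph (u :: s))),
        forall i, is_cycle (c i) /\ 5 <= size (c i) <= 2 * m,
        forall i, [set us i; vs i] \subset sverts (H i)
                  /\ sub_subgraph (path_subgraph (u :: s)) (H i),
        forall i j, i != j -> subgraphI (H i) (H j) = path_subgraph (u :: s)
      & induced (subgraph_bigU H)].
Proof.
move=> /andP[s0 s2] [_ _ indP] usI vsI vsP tP far.
have cl i : closes u s (t i) by case: (tP i).
have dis i j : i != j -> {in t i, forall x, x \notin t j}.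
  move=> ij; have [ci hi li] := tP i; have [cj hj lj] := tP j.
  apply: (arcs_disjoint s0 ci cj); rewrite ?hi ?hj ?li ?lj.
    by apply: contraNneq ij => /vsI ->.
  by apply: contraNneq ij => /usI ->.
exists vs, (fun i => u :: s ++ t i) => H; split=> //.
- move=> i; have [ct st] := cl i; split=> //; rewrite st leqnn andbT.
  by clear -m_ge3; lia.
- move=> i; split; last exact: (sub_path_cycle (u :: s) (t i)).
  have [[_ st] <- <-] := tP i; apply/subsetP => x.
  have : t i != [::].
    by apply/eqP => E; move: st; rewrite E cats0 /=; clear -s2 m_ge3; lia.
  rewrite mem_sverts_cycle -cat_cons mem_cat orbC; case: (t i) => // a b _.
  by case/set2P => ->; rewrite /= ?mem_head ?mem_last.
- move=> i j ij; have [ci _] := cl i; have [cj _] := cl j.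
  exact: cyclesI indP ci cj (dis i j ij).
apply: (bigU_cycles_induced polygon_girth cl) => i j x y ij xi yj.
apply/negP => xy.
have [s1 [[xE yE]|[xE yE]]] := arcs_edge s0 (cl i) (cl j) (dis i j ij) xi yj xy.
  by have := far s1 i j ij; rewrite -xE -yE xy.
by have := far s1 j i; rewrite eq_sym -xE -yE edge_sym xy => /(_ ij).
Qed.

Lemma injection_into (n : nat) (A : {set G}) : n <= #|A| ->
  exists2 f : 'I_n -> G, injective f & forall i, f i \in A.
Proof.
move=> nA; exists (fun i => enum_val (widen_ord nA i)) => [i j|i].
  by move=> /enum_val_inj /(congr1 val) /= /val_inj.
exact: enum_valP.
Qed.

Lemma long_path u v v0 : edge u v -> edge v v0 -> v0 != u ->
  exists2 r, simple_path u (v :: v0 :: r) & size r = m - 2.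
Proof.
move=> uv vv0 v0u.
have P : simple_path u [:: v; v0].
  rewrite simple_path_cons uv simple_path1 // !inE negb_or edge_neq //.
  by rewrite eq_sym v0u.
have [||r Pr sr] := extend_path (k := m) P => //=; try lia.
by exists r => //; move: sr => /=; lia.
Qed.

(** Such an edge would make [l] and [nth u t' (m - 2)] two common neighbors of the entries [m - 1]
    of both arcs. *)
Lemma spokes_nonadjacent u v l t t' :
  closes u [:: v] t -> closes u [:: v] t' ->
  head u t != head u t' -> last u t != last u t' ->
  edge l (nth u t (m - 1)) -> edge l (nth u t' (m - 1)) ->
  nth u t' (m - 2) != l ->
  ~~ edge (nth u t (m - 1)) (nth u t' (m - 2)).
Proof.
move=> C C' hd lst lt lt'; apply: contra => XY.
have st : m - 1 < size t by case: C => _ /=; clear -m_ge3; lia.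
have st' : m - 1 < size t' by case: C' => _ /=; clear -m_ge3; lia.
have dis := arcs_disjoint (isT : 0 < size [:: v]) C C' hd lst.
apply/eqP; apply: (@common_neighbor_unique (nth u t (m - 1)) (nth u t' (m - 1))).
- have xt : nth u t (m - 1) \in t by apply: mem_nth.
  by apply: contraNneq (dis _ xt) => ->; apply: mem_nth.
- by [].
- by rewrite edge_sym.
- have -> : m - 1 = (m - 2).+1 by clear -m_ge3; lia.
  by apply: (closes_edge C'); move: st'; clear -m_ge3; lia.
- by [].
Qed.

Lemma branching_edge n u v : (n < q) || (3 < m) && (n <= q) -> edge u v ->
  forall us : 'I_n -> G, injective us -> (forall i, us i \in Lk u :\ v) ->
  exists (vs : 'I_n -> G) (t : 'I_n -> seq G),
    [/\ injective vs, forall i, vs i \in Lk v :\ u,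
        forall i, [/\ closes u [:: v] (t i), head u (t i) = vs i
                    & last u (t i) = us i]
      & forall i j, i != j ->
          ~~ edge (nth u (t i) (m - 1)) (nth u (t j) (m - 2))].
Proof.
move=> nq uv us usI usP.
have card_v : q <= #|Lk v :\ u|.
  by have := polygon_deg v; rewrite (cardsD1 u); case: (_ \in _); clear; lia.
have lkP x y z : z \in Lk x :\ y -> edge x z /\ z != y.
  by rewrite !inE => /andP[].
(* One path to [last v0 r] serves all spokes; an index with [vs i = v0] gets a dummy arc. *)
have fan v0 (vs : 'I_n -> G) (r : seq G) :
    simple_path u (v :: v0 :: r) -> size r = m - 2 ->
    (forall i, vs i \in Lk v :\ u) ->
    exists t : 'I_n -> seq G, forall i, vs i != v0 ->
      [/\ closes u [:: v] (t i), head u (t i) = vs i /\ last u (t i) = us i,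
         edge (last v0 r) (nth u (t i) (m - 1)),
         simple_path u (v :: v0 :: rcons r (nth u (t i) (m - 1)))
       & nth u (t i) (m - 2) != last v0 r].
  move=> P sr vsP; apply: (@ord_choice _ _ (fun i (t : seq G) => vs i != v0 ->
      [/\ closes u [:: v] t, head u t = vs i /\ last u t = us i,
         edge (last v0 r) (nth u t (m - 1)),
         simple_path u (v :: v0 :: rcons r (nth u t (m - 1)))
       & nth u t (m - 2) != last v0 r])) => i.
  have [viv0|vi] := eqVneq (vs i) v0; first by exists [::].
  have [/= e1 n1] := lkP _ _ _ (usP i); have [/= e2 n2] := lkP _ _ _ (vsP i).
  by have [t Ht] := spoke P sr e1 n1 e2 n2 vi; exists t.
have [nq1|qn] := ltnP n q.
  (* Of [n + 1] neighbors of [v], the extra one [f ord_max] serves as [v0]. *)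
  have [f fI fP] := injection_into (leq_trans nq1 card_v).
  have [e0 n0] := lkP _ _ _ (fP ord_max).
  have [r P sr] := long_path uv e0 n0.
  pose vs i := f (widen_ord (leqnSn n) i).
  have vsI : injective vs by move=> i j /fI /(congr1 val) /= /val_inj.
  have vs0 i : vs i != f ord_max.
    apply/eqP => /fI /(congr1 val) /= E; have := ltn_ord i.
    by rewrite E ltnn.
  have [t tP] := fan _ vs r P sr (fun i => fP _).
  exists vs, t; split=> // [i|i|i j ij]; first exact: fP.
    by have [? [? ?] _ _ _] := tP i (vs0 i).
  have [Ci [hi li] ei _ _] := tP i (vs0 i).
  have [Cj [hj lj] ej _ nj] := tP j (vs0 j).
  apply: (spokes_nonadjacent (l := last (f ord_max) r)) Ci Cj _ _ ei ej nj.
    by rewrite hi hj; apply: contraNneq ij => /vsI ->.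
  by rewrite li lj; apply: contraNneq ij => /usI ->.
(* Now [n = q], so [v0] is taken to be [vs i0], and the arc at [i0] comes from [last_spoke]. *)
have /andP[m4 nq'] : (3 < m) && (n <= q) by move: nq; rewrite ltnNge qn.
have n_gt0 : 0 < n by apply: leq_trans qn; apply: ltnW polygon_q.
pose i0 := Ordinal n_gt0.
have [vs vsI vsP] := injection_into (leq_trans nq' card_v).
have [e0 n0] := lkP _ _ _ (vsP i0).
have [r P sr] := long_path uv e0 n0.
have [T TP] := fan _ vs r P sr vsP.
have vs0 i : i != i0 -> vs i != vs i0 by apply: contra_neq => /vsI.
have us0 i : i != i0 -> us i != us i0 by apply: contra_neq => /usI.
have [e1 n1] := lkP _ _ _ (usP i0).
have [|t0 [C0 [h0 l0] Y0 far0]] := last_spoke m4 nq' P sr e1 n1 (T := T) (i0 := i0).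
  move=> i ni; have [Ci [hi li] _ _ _] := TP i (vs0 i ni).
  by rewrite hi li vs0 ?us0.
exists vs, (fun i => if i == i0 then t0 else T i); split=> //.
  by move=> i; case: eqP => [->|/eqP /vs0 /TP[? [? ?] _ _ _]].
move=> i j ij; have [iE|ni] := eqVneq i i0; have [jE|nj] := eqVneq j i0.
- by rewrite iE jE eqxx in ij.
- exact: far0.
- have [Ci [hi li] ei Pi _] := TP i (vs0 i ni).
  set X := nth u (T i) (m - 1) in Pi *.
  have XT : X \in T i.
    by apply: mem_nth; case: Ci => _ /= E; move: E; clear -m_ge3; lia.
  have XNt : X \notin t0.
    by apply: (arcs_disjoint (isT : 0 < size [:: v]) Ci C0) XT;
      rewrite ?hi ?h0 ?li ?l0 ?vs0 ?us0.
  (* If [X] were adjacent to the entry [m - 2] of [t0], two paths of length [m - 1] from [vs i0] to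
     [X], along [t0] and along [r], would coincide, and that entry would be [last (vs i0) r]. *)
  apply: contra Y0 => XY; apply/eqP.
  case: t0 C0 h0 XY XNt {l0 far0} => [|v1 t0] C0 /= h0 XY XNt.
    by case: C0 => _ /= E; exfalso; move: E; clear -m_ge3; lia.
  rewrite {v1}h0 in C0 XY XNt *.
  have st0 : m - 2 <= size t0 by case: C0 => _ /=; clear -m_ge3; lia.
  have lt0 : last (vs i0) (take (m - 2) t0) = nth u (vs i0 :: t0) (m - 2).
    rewrite (last_nth u) size_takel //.
    rewrite -[vs i0 :: take _ _]/(take (m - 2).+1 (vs i0 :: t0)).
    by rewrite nth_take.
  have Q : simple_path (vs i0) (rcons (take (m - 2) t0) X).
    rewrite -cats1; apply: simple_path_cat => [||z].
    - have [ct _] := C0; move: ct; rewrite is_cycle_cons => /and3P[_ _].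
      move=> /(@simple_path_suffix _ u (vs i0) [:: v]).
      by rewrite -{1}(cat_take_drop (m - 2) t0) => /simple_path_prefix.
    - by rewrite lt0 simple_path1 // edge_sym.
    rewrite inE => /eqP ->; apply: contra XNt.
    by rewrite !inE => /orP[-> //|/mem_take ->]; rewrite orbT.
  have Q' : simple_path (vs i0) (rcons r X) := @simple_path_suffix _ u _ [:: v] _ Pi.
  have E : rcons (take (m - 2) t0) X = rcons r X.
    apply: (simple_path_inj polygon_girth Q Q'); rewrite ?last_rcons //.
    by rewrite !size_rcons size_takel // sr; clear -m_ge3; lia.
  by case/rcons_inj: E => E; rewrite -lt0 E.
have [Ci [hi li] ei _ _] := TP i (vs0 i ni).
have [Cj [hj lj] ej _ yj] := TP j (vs0 j nj).
apply: (spokes_nonadjacent (l := last (vs i0) r)) Ci Cj _ _ ei ej yj.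
  by rewrite hi hj; apply: contraNneq ij => /vsI ->.
by rewrite li lj; apply: contraNneq ij => /usI ->.
Qed.

(** Any distinct neighbors of [v] other than [w] can serve as [vs]: the path from [us i] through
    [u], [w], [v] to [vs i] has length 4, at most [m + 1]. *)
Lemma branching_two_edges n u w v : n <= q -> simple_path u [:: w; v] ->
  forall us : 'I_n -> G, injective us -> (forall i, us i \in Lk u :\ w) ->
  exists (vs : 'I_n -> G) (t : 'I_n -> seq G),
    [/\ injective vs, forall i, vs i \in Lk v :\: [set u; w; v]
      & forall i, [/\ closes u [:: w; v] (t i), head u (t i) = vs i
                    & last u (t i) = us i]].
Proof.
move=> nq P us usI usP.
have card_v : q <= #|Lk v :\ w|.
  by have := polygon_deg v; rewrite (cardsD1 w); case: (_ \in _); clear; lia.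
have [vs vsI vsP] := injection_into (leq_trans nq card_v).
have P2 i : simple_path u [:: w; v; vs i].
  have := vsP i; rewrite !inE => /andP[vw vv].
  by apply: (simple_path_rcons polygon_girth (p := [:: w])) => //=; clear -m_ge3; lia.
have P3 i : simple_path (us i) [:: u; w; v; vs i].
  have := usP i; rewrite !inE => /andP[uw uu].
  apply: (simple_path_belast polygon_girth) => //=; first by rewrite edge_sym.
  by clear -m_ge3; lia.
have [t tP] : exists t : 'I_n -> seq G, forall i,
    [/\ closes u [:: w; v] (t i), head u (t i) = vs i & last u (t i) = us i].
  apply: (@ord_choice _ _ (fun i (t : seq G) =>
    [/\ closes u [:: w; v] t, head u t = vs i & last u t = us i])) => i.
  have [|t ct st] := complete_path (P3 i); first by clear -m_ge3 => /=; lia.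
  exists (vs i :: rcons t (us i)); split=> //=; last by rewrite last_rcons.
  split; last by rewrite -st /= size_rcons.
  rewrite -cats1 (_ : _ :: _ = [:: u, w, v, vs i & t] ++ [:: us i]) //.
  by rewrite is_cycle_catC.
exists vs, t; split=> // i; have := vsP i; rewrite !inE => /andP[vw vv].
have [/andP[_ /= /andP[uN _]] vNvi] := (P2 i, edge_neq vv).
rewrite !negb_or vv vw [_ == v]eq_sym vNvi !andbT.
by apply: contraNneq uN => ->; rewrite !inE eqxx !orbT.
Qed.

Lemma polygon_branching n :
  0 < n -> (n < q) || (3 < m) && (n <= q) -> branching n (2 * m) G.
Proof.
move=> n0 nq; have nq' : n <= q by case/orP: nq => [/ltnW|/andP[]].
split=> [|x|u s indP s12 v P us usI usP]; first by split=> //; clear -m_ge3; lia.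
  by rewrite addn1; apply: leq_trans (polygon_deg x).
have Pus : simple_path u s by case: indP => pP uP _; apply/andP.
case: s @v @P indP s12 Pus usP => [|w [|v [|? ?]]] // v' P indP s12 Pus usP.
  have uw : edge u w by move: Pus; rewrite simple_path_cons => /andP[].
  have [|vs [t [vsI vsP tP far]]] := branching_edge nq uw usI.
    by move=> i; have := usP i; rewrite !inE !negb_or -!andbA => /and3P[_ -> ->].
  apply: (branching_conclusion s12 indP usI vsI _ tP) => // i.
  have := vsP i; rewrite !inE => /andP[vu wv].
  by rewrite negb_or vu wv eq_sym edge_neq.
have [|vs [t [vsI vsP tP]]] := branching_two_edges nq' Pus usI.
  by move=> i; have := usP i; rewrite !inE !negb_or => /andP[/and3P[_ -> _] ->].
apply: (branching_conclusion s12 indP usI vsI _ tP) => // i.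
have := vsP i; rewrite !inE !negb_or => /andP[/andP[/andP[-> ->] ->] ->].
by [].
Qed.

End Polygon.

(** * The number of cycles for [m = 3] *)

(** From [1 < sqrt q <= q] follows [1 <= q + 1 - sqrt q < q]. *)
Lemma truncn_sqrt_bounds (q : nat) : 2 <= q ->
  0 < Num.truncn (q%:R + 1 - sqrtC q%:R : algC)%R < q.
Proof.
move=> q2; have s0 : (0 <= sqrtC q%:R :> algC)%R by rewrite sqrtC_ge0 ler0n.
have s1 : (1 < sqrtC q%:R :> algC)%R.
  by rewrite -[ltLHS]sqrtC1 ltr_sqrtC ?qualifE /= ?ler01 ?ler0n ?ltr1n.
have sq : (sqrtC q%:R <= q%:R :> algC)%R.
  by rewrite -{2}(sqrtCK q%:R) expr2 ler_peMr // ltW.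
have le1 : (1 <= q%:R + 1 - sqrtC q%:R :> algC)%R by rewrite lerBrDl lerD2r.
rewrite truncn_gt0 le1 truncn_lt_nat ?(le_trans ler01) //.
by rewrite ltrBlDl addrC ltrD2r.
Qed.

Theorem proposition6p3 (m q : nat) (hm : 3 <= m) (hq : 2 <= q)
    (G : sgraph) (hG : generalized_polygon m q G) :
  branching
    (if 3 < m then q
     else Num.truncn (q%:R + 1 - sqrtC q%:R : algC)%R)
    (2 * m) G.
Proof.
have /andP[n0 nq] := truncn_sqrt_bounds hq.
case: ifP => m4; apply: (polygon_branching hm hG) => //.
- exact: ltnW.
- by rewrite m4 leqnn orbT.
- by rewrite nq.
Qed.
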